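(* Assume that (1) the chain with kernel $p$ has a unique stationary distribution $\mu$ and $\mu(U)>0$ for every non-empty (relatively) open $U\subseteq\mathcal S$; (2) $\sup_{s\in\mathcal S}\|x(s)\|<\infty$ and $\sup_{s\in\mathcal S}|r(s)|<\infty$; (3) for every measurable $f:\mathcal S\to\mathbb R^n$ with $f=0$ $\mu$-a.e., also $P_\pi f=0$ $\mu$-a.e. If $\mathcal W\subset\mathbb R^d$ is a bounded invariant set of the ODE $\frac{dw(t)}{dt}=Aw(t)+b$, then $\mathcal W\subseteq\mathcal W_*$.
   Context: Setting: $K,d\in\mathbb N$; $\mathcal S\subseteq\mathbb R^K$ with its Borel $\sigma$-algebra; $p(\cdot\mid s)$ is a Markov transition kernel on $\mathcal S$; $r:\mathcal S\to\mathbb R$ is measurable; $\gamma\in[0,1)$; $x:\mathcal S\to\mathbb R^d$ is a measurable feature map (no linear independence is assumed). $(P_\pi f)(s)=\int_{\mathcal S}f(s')\,p(ds'\mid s)$. A stationary distribution is a probability measure $\mu$ with $\mu(Z)=\int_{\mathcal S}p(Z\mid s)\mu(ds)$ for all Borel $Z\subseteq\mathcal S$. $A=\int_{\mathcal S}x(s)\left(\gamma(P_\pi x)(s)^\top-x(s)^\top\right)\mu(ds)\in\mathbb R^{d\times d}$, $b=\int_{\mathcal S}x(s)r(s)\mu(ds)\in\mathbb R^d$, $\mathcal W_*=\{w\in\mathbb R^d: Aw+b=0\}$. A set $\mathcal W$ is an invariant set of the ODE if for every solution $w(t)$ on $(-\infty,\infty)$, $w(0)\in\mathcal W$ implies $w(t)\in\mathcal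 W$ for all $t\in(-\infty,\infty)$. *)

(* Defs.v *)
From HB Require Import structures.
From mathcomp Require Import all_boot all_order all_algebra.
From mathcomp Require Import all_classical all_reals all_analysis.

Set Implicit Arguments.
Unset Strict Implicit.
Unset Printing Implicit Defensive.

Import Order.TTheory GRing.Theory Num.Theory.
Import numFieldNormedType.Exports.

Local Open Scope classical_set_scope.
Local Open Scope ring_scope.

(* [measurableType] requires a point, hence the non-emptiness proof carried by
   the type. The topology is the relative one inherited from [T]. *)
Definition subspace_type (T : topologicalType) (S : set T) (S0 : S !=set0) :
  Type := set_type S.

HB.instance Definition _ (T : topologicalType) (S : set T) (S0 : S !=set0) :=
  Topological.copy (subspace_type S0) (set_type S).
HB.instance Definition _ (T : topologicalType) (S : set T) (S0 : S !=set0) :=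
  isPointed.Build (subspace_type S0)
    (exist _ (projT1 (cid S0)) (mem_set (projT2 (cid S0)))).

Notation borelType T := (g_sigma_algebraType (@open T)).

Definition borel_fun d (X : measurableType d) (T : ptopologicalType)
  (f : X -> T) : Prop := measurable_fun [set: X] (f : X -> borelType T).

(* Entrywise. [Rintegral] is total: entries whose integral is not finite are
   sent to [0]. *)
Definition mxintegral d (X : measurableType d) (R : realType)
  (mu : {measure set X -> \bar R}) (m n : nat) (F : X -> 'M[R]_(m, n)) :
  'M[R]_(m, n) := \matrix_(i, j) \int[mu]_s F s i j.

Definition transition_op d (X : measurableType d) (R : realType)
  (p : R.-pker X ~> X) (n : nat) (f : X -> 'cV[R]_n) (s : X) : 'cV[R]_n :=
  mxintegral (p s) f.

Definition stationary d (X : measurableType d) (R : realType)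
  (p : R.-pker X ~> X) (mu : probability X R) : Prop :=
  forall Z : set X, measurable Z -> mu Z = (\int[mu]_s p s Z)%E.

(* Measures are functions on all sets, so they are only compared on measurable
   ones. *)
Definition unique_stationary d (X : measurableType d) (R : realType)
  (p : R.-pker X ~> X) (mu : probability X R) : Prop :=
  stationary p mu /\
  forall nu : probability X R, stationary p nu ->
    forall Z : set X, measurable Z -> nu Z = mu Z.

Definition td_matrix d (X : measurableType d) (R : realType)
  (p : R.-pker X ~> X) (mu : probability X R) (gamma : R) (k : nat)
  (x : X -> 'cV[R]_k) : 'M[R]_k :=
  mxintegral mu
    (fun s => x s *m (gamma *: (transition_op p x s)^T - (x s)^T)).

Definition td_vector d (X : measurableType d) (R : realType)
  (mu : probability X R) (r : X -> R) (k : nat) (x : X -> 'cV[R]_k) :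
  'cV[R]_k := mxintegral mu (fun s => r s *: x s).

Definition affine_zeros (R : realType) (k : nat) (A : 'M[R]_k) (b : 'cV[R]_k) :
  set 'cV[R]_k := [set w | A *m w + b = 0].

Definition affine_ode_solution (R : realType) (k : nat) (A : 'M[R]_k)
  (b : 'cV[R]_k) (w : R -> 'cV[R]_k) : Prop :=
  forall t : R, is_derive t 1 w (A *m w t + b).

Definition affine_ode_invariant (R : realType) (k : nat) (A : 'M[R]_k)
  (b : 'cV[R]_k) (W : set 'cV[R]_k) : Prop :=
  forall w : R -> 'cV[R]_k, affine_ode_solution A b w ->
    W (w 0) -> forall t : R, W (w t).

(* Main.v *)
(* For f_z(s) = z^T x(s) and q(z) = \int f_z^2 dmu, stationarity and Jensen's
   inequality give \int (P f_z)^2 dmu <= q(z), hence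
     z^T A z <= - (1 - gamma) q(z)   and   |A z|^2 <= D q(z).
   So A and A^T have the same kernel {q = 0}, to which b is orthogonal; thus
   y = A w + b stays in the range of A, where A is invertible, so that
   V = |y|^2 satisfies V' = 2 y^T A y <= - c V along every solution. A solution
   that is bounded on (-oo, 0] then has V(0) = 0, since V(0) > 0 would force V
   to grow at least linearly backwards in time. As invariance says something
   about a point only through a solution defined on the whole line, such a
   solution is built as a power series. *)
Require Import Defs.
From HB Require Import structures.
From mathcomp Require Import all_boot all_order all_algebra.
From mathcomp Require Import all_classical all_reals all_analysis.
From mathcomp Require Import measurable_realfun ring lra.

Set Implicit Arguments.
Unset Strict Implicit.
Unset Printing Implicit Defensive.

Import Order.TTheory GRing.Theory Num.Theory.
Import numFieldNormedType.Exports.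

Local Open Scope classical_set_scope.
Local Open Scope ring_scope.

(** * A differential inequality on the whole line *)

Lemma decay_eq0 (R : realType) (V dV : R -> R) (c M : R) :
  0 < c -> (forall t, is_derive t (1 : R) V (dV t)) ->
  (forall t, dV t <= - c * V t) -> (forall t, 0 <= V t <= M) -> V 0 = 0.
Proof.
move=> c0 VdV dVle VM.
have Vcont (A : set R) : {within A, continuous V}.
  apply: continuous_subspaceT => t.
  by apply: differentiable_continuous; apply/derivable1_diffP; case: (VdV t).
have mvt (a b : R) : a <= b -> exists2 e, a <= e <= b & V b - V a = dV e * (b - a).
  move=> ab; have [e] := @MVT_segment _ V dV a b ab (fun x _ => VdV x) (Vcont _).
  by rewrite in_itv/= => abe Ve; exists e.
(* Since [V' <= - c V <= 0], [V] is nonincreasing, hence at least [V 0] on the negative axis. *)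
have V0le (t : R) : t <= 0 -> V 0 <= V t.
  move=> t0; have [e _ Ve] := mvt _ _ t0.
  have /andP[Ve0 _] := VM e.
  have dVe0 : dV e <= 0 by rewrite (le_trans (dVle e))// mulNr oppr_le0 mulr_ge0// ltW.
  have : 0 <= dV e * t by exact: mulr_le0.
  by move: Ve; rewrite sub0r mulrN; lra.
(* Left of 0 the slope is therefore at most [- c * V 0], so [V (- t)] is at least
   [V 0 * (1 + c * t)]. *)
have key (t : R) : 0 <= t -> V 0 * (1 + c * t) <= M.
  move=> t0; have nt0 : - t <= 0 by rewrite oppr_le0.
  have [e /andP[_ e0] Ve] := mvt _ _ nt0.
  have V0e := V0le _ e0; have dVe := dVle e; have /andP[_ VtM] := VM (- t).
  have cV : c * V 0 <= c * V e by rewrite ler_wpM2l// ltW.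
  have : dV e * t <= - (c * V 0) * t by apply: ler_wpM2r => //; lra.
  by move: Ve; rewrite sub0r opprK; lra.
have /andP[V00 V0M] := VM 0.
apply/eqP; rewrite eq_le V00 andbT leNgt; apply/negP => V0gt.
have M0 : 0 <= M by exact: le_trans V0M.
(* At time [M / (c * V 0)] this lower bound equals [V 0 + M], which exceeds [M]. *)
have := key _ (divr_ge0 M0 (mulr_ge0 (ltW c0) V00)).
have -> : V 0 * (1 + c * (M / (c * V 0))) = V 0 + M by field; rewrite !gt_eqF.
by lra.
Qed.

(** * Global existence by power series *)

Lemma is_cvg_pseries_fact (R : realType) (a : R^nat) (C M x : R) :
  0 <= M -> (forall n, `|a n| <= C * M ^+ n) ->
  cvgn (pseries (fun n => a n / n`!%:R) x).
Proof.
move=> M0 aCM; apply: normed_cvg.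
(* The series is dominated by [C] times the exponential series at [M * |x|]. *)
have CM : cvgn (series (C *: exp_coeff (M * `|x|))).
  exact/is_cvg_seriesZ/is_cvg_series_exp_coeff.
have C0 : 0 <= C by rewrite (le_trans (normr_ge0 _) (le_trans (aCM 0%N) _))// expr0 mulr1.
apply: series_le_cvg CM => n.
- exact: normr_ge0.
- by rewrite mulr_ge0//= exp_coeff_ge0// mulr_ge0.
- rewrite /= !normrM normrX normfV (ger0_norm (ler0n _ _)).
  rewrite [leRHS](_ : _ = C * M ^+ n / n`!%:R * `|x| ^+ n); last first.
    by rewrite fctE /exp_coeff/= exprMn /GRing.scale/=; ring.
  by rewrite !ler_wpM2r// ?exprn_ge0// invr_ge0.
Qed.

Section affine_ode_existence.
Context (R : realType) (k : nat) (A : 'M[R]_k) (b w0 : 'cV[R]_k).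

(* [U n] is the [n]-th derivative at 0 of the solution starting from [w0]. *)
Let U (n : nat) : 'cV[R]_k :=
  if n is m.+1 then iter m (mulmx A) (A *m w0 + b) else w0.

(** The equation differentiated [n] times at 0: the constant [b] survives only for [n = 0]. *)
Let US n : U n.+1 = A *m U n + (n == 0)%:R *: b.
Proof. by case: n => [|n] /=; rewrite ?scale1r// scale0r addr0. Qed.

Let U_bound : exists C M, 0 <= M /\ forall n i, `|U n i 0| <= C * M ^+ n.
Proof.
(* [C] dominates both [w0] and the first derivative [A *m w0 + b]; each further derivative costs a
   factor [M], which bounds the row sums of [|A i j|]. *)
pose C : R := \sum_j `|w0 j 0| + \sum_j `|(A *m w0 + b) j 0|.
pose M : R := 1 + \sum_i \sum_j `|A i j|.
have sum0 (v : 'cV[R]_k) : 0 <= \sum_j `|v j 0| by exact: sumr_ge0.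
have le_sum (v : 'cV[R]_k) i : `|v i 0| <= \sum_j `|v j 0|.
  by rewrite (bigD1 i)//= lerDl sumr_ge0.
have M1 : 1 <= M by rewrite lerDl; do 2 apply: sumr_ge0 => ? _.
have M0 : 0 <= M by exact: le_trans M1.
have C0 : 0 <= C by rewrite addr_ge0.
exists C, M; split => // -[|n] i.
  by rewrite expr0 mulr1 (le_trans (le_sum _ _))// lerDl.
(* [U n.+1] contains only [n] factors [A], so one factor [M >= 1] is given away. *)
apply: (@le_trans _ _ (C * M ^+ n)); last first.
  by rewrite ler_wpM2l// exprS ler_peMl// exprn_ge0.
elim: n i => [|n IHn] i /=.
  by rewrite expr0 mulr1 (le_trans (le_sum _ _))// lerDr.
rewrite mxE (le_trans (ler_norm_sum _ _ _))//.
apply: (@le_trans _ _ (\sum_j `|A i j| * (C * M ^+ n))).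
  by apply: ler_sum => j _; rewrite normrM ler_wpM2l.
rewrite -mulr_suml exprS [leRHS]mulrCA ler_wpM2r ?mulr_ge0 ?exprn_ge0//.
by rewrite /M [X in 1 + X](bigD1 i)//= addrCA lerDl addr_ge0// sumr_ge0// => ? _; exact: sumr_ge0.
Qed.

(** Taylor coefficients at 0 of the [i]-th coordinate of the [m]-th derivative; differentiating term
    by term only raises [m]. *)
Let c m i n : R := U (n + m) i 0 / n`!%:R.

Let cvg_c m i x : cvgn (pseries (c m i) x).
Proof.
have [C [M [M0 UCM]]] := U_bound.
apply: (@is_cvg_pseries_fact _ _ (C * M ^+ m) M) => // n.
by rewrite (le_trans (UCM _ _))// addnC exprD mulrA.
Qed.

Let diffs_c m i : pseries_diffs (c m i) = c m.+1 i.
Proof.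
apply/funext => n; rewrite /pseries_diffs /c addnS addSn factS natrM invfM.
by rewrite mulrCA mulVKf.
Qed.

Let w t : 'cV[R]_k := \col_i limn (pseries (c 0 i) t).

Let derive_w t i : is_derive t (1 : R) (fun t => w t i 0) (limn (pseries (c 1 i) t)).
Proof.
rewrite -diffs_c.
under [X in is_derive _ _ X]eq_fun do rewrite mxE.
(* Termwise differentiation at [t] requires convergence at a point of larger modulus, here
   [|t| + 1]. *)
apply: (@pseries_snd_diffs _ _ (`|t| + 1)); rewrite ?diffs_c; try exact: cvg_c.
by rewrite [ltRHS]ger0_norm ?addr_ge0// ltrDl.
Qed.

Let c1E t i : limn (pseries (c 1 i) t) = (A *m w t + b) i 0.
Proof.
(* After the shift every partial sum contains the term of index 0, the only one where [b] occurs. *)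
apply/cvg_lim => //; rewrite -cvg_shiftS !mxE.
under eq_cvg => n.
  rewrite /pseries/= /series/=.
  under eq_bigr => m _.
    rewrite /c addn1 US !mxE mulrDl mulrDl mulr_suml mulr_suml.
    under eq_bigr do rewrite -!mulrA.
    over.
  rewrite big_split/= exchange_big/=.
  rewrite [X in _ + X](_ : _ = b i 0); last first.
    rewrite big_nat_recl//= fact0 expr0 divr1 !mulr1 mul1r big1 ?addr0// => j _.
    by rewrite !mul0r.
  under eq_bigr do rewrite -mulr_sumr.
  over.
apply: cvgD; last exact: cvg_cst.
apply: cvg_big => [|j _]; first exact: add_continuous.
apply: cvgMl_tmp; rewrite mxE.
rewrite (_ : (fun _ => _) = (fun n => pseries (c 0 j) t n.+1)); last first.
  apply/funext => n; rewrite /pseries/series/=; apply: eq_bigr => m _.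
  by rewrite /c addn0 mulrA.
by rewrite cvg_shiftS; exact: cvg_c.
Qed.

Lemma affine_ode_solution_exists :
  exists2 w, affine_ode_solution A b w & w 0 = w0.
Proof.
exists w; last first.
  (* At time 0 only the constant term remains, and the shift ensures that it is present. *)
  apply/colP => i; rewrite mxE; apply/cvg_lim => //; rewrite -cvg_shiftS.
  rewrite (_ : (fun _ => _) = cst (w0 i 0)); first exact: cvg_cst.
  apply/funext => n; rewrite /pseries/series/= big_nat_recl//= big1 => [|m _].
    by rewrite /c/= fact0 expr0 divr1 mulr1 addr0.
  by rewrite expr0n/= mulr0.
move=> t; have dw : derivable w t 1.
  by apply/derivable_mxP => i j; rewrite ord1; case: (derive_w t i).
apply: DeriveDef => //; rewrite derive_mx//; apply/colP => i; rewrite mxE.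
by rewrite -c1E; case: (derive_w t i).
Qed.

End affine_ode_existence.

(** * Scalar product and Cauchy-Schwarz inequality *)

Section dotv.
Context (R : realFieldType) (k : nat).
Implicit Types (u v : 'cV[R]_k) (Q : 'M[R]_k).

Definition dotv u v : R := (u^T *m v) 0 0.

Lemma dotvE u v : dotv u v = \sum_i u i 0 * v i 0.
Proof. by rewrite /dotv mxE; apply: eq_bigr => i _; rewrite mxE. Qed.

Lemma dotv_ge0 u : 0 <= dotv u u.
Proof. by rewrite dotvE sumr_ge0// => i _; rewrite -expr2 sqr_ge0. Qed.

Lemma dotv_eq0 u : dotv u u = 0 -> u = 0.
Proof.
rewrite dotvE => /eqP; rewrite psumr_eq0 => [/allP u0|i _]; last first.
  by rewrite -expr2 sqr_ge0.
apply/colP => i; have := u0 i (mem_index_enum _).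
by rewrite mulf_eq0 orbb mxE => /eqP.
Qed.

(** Lagrange's identity: once the right-hand side is symmetrized in [i] and [j], the two sides
    differ term by term by half of [(u_i v_j - u_j v_i)^2]. *)
Lemma dotv_sqr_le u v : dotv u v ^+ 2 <= dotv u u * dotv v v.
Proof.
have uv2 : \sum_i \sum_j (u i 0 * v j 0) ^+ 2 = dotv u u * dotv v v.
  rewrite !dotvE big_distrlr; apply: eq_bigr => i _; apply: eq_bigr => j _.
  by rewrite /=; ring.
have uuvv : dotv u u * dotv v v =
    \sum_i \sum_j 2^-1 * ((u i 0 * v j 0) ^+ 2 + (u j 0 * v i 0) ^+ 2).
  under eq_bigr do rewrite -mulr_sumr big_split/=.
  by rewrite -mulr_sumr big_split/= [X in _ + X]exchange_big/= !uv2; lra.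
rewrite uuvv expr2 [in leLHS]dotvE big_distrlr/=.
apply: ler_sum => i _; apply: ler_sum => j _.
by have := sqr_ge0 (u i 0 * v j 0 - u j 0 * v i 0); lra.
Qed.

(** Cauchy-Schwarz on each row; the constant is the squared Frobenius norm of [Q]. *)
Lemma dotv_mulmx_le Q v :
  dotv (Q *m v) (Q *m v) <= (\sum_i \sum_j Q i j ^+ 2) * dotv v v.
Proof.
rewrite [leLHS]dotvE mulr_suml; apply: ler_sum => i _.
have -> : (Q *m v) i 0 = dotv (row i Q)^T v.
  by rewrite dotvE mxE; apply: eq_bigr => j _; rewrite !mxE.
rewrite -expr2 (le_trans (dotv_sqr_le _ _))// ler_wpM2r ?dotv_ge0// dotvE.
by under eq_bigr do rewrite !mxE -expr2.
Qed.

End dotv.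

(** * Kernels and ranges of square matrices *)

Section matrix_range.
Context (F : fieldType) (k : nat) (A : 'M[F]_k).

(** The columns of [cokermx A] lie in the kernel of [A], hence in that of [B], which places the row
    space of [B] inside that of [A]. *)
Lemma mulmx_factor (B : 'M[F]_k) :
  (forall z : 'cV[F]_k, A *m z = 0 -> B *m z = 0) -> exists Q, B = Q *m A.
Proof.
move=> AB; apply/submxP; rewrite submxE; apply/eqP.
have := mulmx_coker A; move: (cokermx A) => C AC; apply/matrixP => i j.
have := AB (col j C); rewrite colE !mulmxA AC mul0mx -colE.
by move=> /(_ erefl)/colP/(_ i); rewrite !mxE.
Qed.

(** Fredholm alternative: the argument of [mulmx_factor] for the row [b^T] and the matrix [A^T],
    then transposed. *)
Lemma mulmx_range (b : 'cV[F]_k) :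
  (forall z : 'cV[F]_k, A^T *m z = 0 -> b^T *m z = 0) -> exists v, b = A *m v.
Proof.
move=> Ab; have : (b^T <= A^T)%MS.
  rewrite submxE; apply/eqP.
  have := mulmx_coker A^T; move: (cokermx A^T) => C AC; apply/matrixP => i j.
  have := Ab (col j C); rewrite colE !mulmxA AC mul0mx -colE.
  by move=> /(_ erefl)/colP/(_ i); rewrite !mxE.
by case/submxP => D bE; exists D^T; rewrite -[b]trmxK bE trmx_mul trmxK.
Qed.

End matrix_range.

(** * Bounded solutions of an affine equation *)

Lemma is_derive_fct_sum (R : realType) k (h : 'I_k -> R -> R) (dh : 'I_k -> R)
    (t : R) :
  (forall i, is_derive t (1 : R) (h i) (dh i)) ->
  is_derive t (1 : R) (fun t => \sum_i h i t) (\sum_i dh i).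
Proof.
move=> hdh; rewrite (_ : (fun _ => _) = \sum_i h i).
  exact: is_derive_sum.
by apply/funext => s; rewrite fct_sumE.
Qed.

Lemma is_derive_mx_coord (R : realType) m n (w : R -> 'M[R]_(m, n)) dw (t : R) i j :
  is_derive t (1 : R) w dw -> is_derive t (1 : R) (fun t => w t i j) (dw i j).
Proof.
case=> wt <-; apply: DeriveDef; first by move/derivable_mxP : wt; exact.
by rewrite derive_mx// mxE.
Qed.

Lemma is_derive_mulmx_affine (R : realType) k (A : 'M[R]_k) (b : 'cV[R]_k)
    (w : R -> 'cV[R]_k) dw (t : R) i :
  is_derive t (1 : R) w dw ->
  is_derive t (1 : R) (fun t => (A *m w t + b) i 0) ((A *m dw) i 0).
Proof.
move=> wdw.
rewrite (_ : (fun _ => _) = (fun t => \sum_j A i j * w t j 0 + b i 0)); last first.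
  by apply/funext => s; rewrite !mxE.
have dwi j := is_derive_mx_coord j 0 wdw.
have dA : is_derive t (1 : R) (fun t => \sum_j A i j * w t j 0) ((A *m dw) i 0).
  by rewrite mxE; apply: is_derive_fct_sum => j; exact: is_deriveZ.
by apply: is_derive_eq; rewrite addr0.
Qed.

(** The dynamical half of the argument, separated from the probabilistic one: the kernel conditions
    put [y = A w + b] in the range of [A] and make [A] injective there, so that dissipation in terms
    of [|A y|^2] controls [|y|^2]. *)
Lemma bounded_affine_ode_solution (R : realType) k (A : 'M[R]_k)
    (b : 'cV[R]_k) (w : R -> 'cV[R]_k) (c M : R) :
  0 < c ->
  (forall z, dotv z (A *m z) <= - c * dotv (A *m z) (A *m z)) ->
  (forall z : 'cV[R]_k, A *m z = 0 -> A^T *m z = 0) ->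
  (forall z : 'cV[R]_k, A^T *m z = 0 -> b^T *m z = 0) ->
  affine_ode_solution A b w -> (forall t i, `|w t i 0| <= M) ->
  A *m w 0 + b = 0.
Proof.
move=> c0 Aneg kerA kerb wsol wM.
have [v bE] := mulmx_range kerb.
(* If [A] kills [A *m z], so does [A^T]; then [A *m z] is orthogonal to the range of [A], to which
   it belongs. *)
have kerAA (z : 'cV[R]_k) : (A *m A) *m z = 0 -> A *m z = 0.
  rewrite -mulmxA => AAz0; apply: dotv_eq0; rewrite /dotv.
  by rewrite mulmxA -[in X in _ *m X *m _](trmxK A) -trmx_mul kerA// trmx0 mul0mx mxE.
(* [A = Q A A]: on its range, [A] has the left inverse [Q]. *)
have [Q AQ] := mulmx_factor kerAA.
pose y t := A *m w t + b.
have yQ t : y t = Q *m (A *m y t).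
  by rewrite /y bE -mulmxDr [in LHS]AQ !mulmxA.
(* The added 1 makes [C] positive, as it becomes a divisor. *)
pose C := 1 + \sum_i \sum_j Q i j ^+ 2.
have C0 : 0 < C.
  by rewrite ltr_pwDl// sumr_ge0// => i _; rewrite sumr_ge0// => j _; exact: sqr_ge0.
have yC t : dotv (y t) (y t) <= C * dotv (A *m y t) (A *m y t).
  rewrite [in leLHS]yQ (le_trans (dotv_mulmx_le _ _))// ler_wpM2r ?dotv_ge0//.
  by rewrite lerDr.
pose V t := dotv (y t) (y t); pose dV t := 2 * dotv (y t) (A *m y t).
(* The rate comes from [y^T A y <= - c |A y|^2 <= - (c / C) |y|^2], doubled by differentiating a
   square; the bound estimates each coordinate of [A w + b] through [M]. *)
apply: dotv_eq0; apply: (@decay_eq0 _ V dV (2 * (c / C))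
    (\sum_i (\sum_j `|A i j| * M + `|b i 0|) ^+ 2)).
- by rewrite mulr_gt0// divr_gt0.
- move=> t; rewrite /V /dV.
  under [X in is_derive _ _ X]eq_fun do rewrite dotvE.
  rewrite dotvE mulr_sumr; apply: is_derive_fct_sum => i.
  have dyi : is_derive t (1 : R) (fun t => y t i 0) ((A *m y t) i 0).
    exact: is_derive_mulmx_affine.
  apply: is_derive_eq.
  by rewrite /GRing.scale/=; ring.
- move=> t; rewrite /V /dV; have := yC t; have := Aneg (y t).
  set p := dotv _ (A *m _); set q := dotv (A *m _) _; set s := dotv _ _ => pq sq.
  have : s / C <= q by rewrite ler_pdivrMr// mulrC.
  move/(ler_wpM2l (ltW c0)).
  by rewrite mulrA mulrAC; lra.
- move=> t; rewrite dotv_ge0/= /V dotvE; apply: ler_sum => i _.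
  rewrite -expr2 -real_normK ?num_real// ler_sqr ?nnegrE ?normr_ge0//; last first.
    rewrite addr_ge0// sumr_ge0// => j _; rewrite mulr_ge0//.
    exact: le_trans (wM 0 j).
  rewrite mxE (le_trans (ler_normD _ _))// lerD2r mxE (le_trans (ler_norm_sum _ _ _))//.
  by apply: ler_sum => j _; rewrite normrM ler_wpM2l.
Qed.

(** * Integrals of bounded measurable functions *)

Section bounded_measurable.
Context d (X : measurableType d) (R : realType).
Implicit Types f g : X -> R.

(** A class closed under sums and products, preserved by the kernel and integrable for every
    probability measure, so it serves [mu] and all the [p s] at once. *)
Definition bounded_measurable f :=
  measurable_fun setT f /\ exists M, forall s, `|f s| <= M.

Lemma bounded_measurable_cst c : bounded_measurable (fun=> c).
Proof. by split; [exact: measurable_cst|exists `|c|]. Qed.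

Lemma bounded_measurableD f g : bounded_measurable f -> bounded_measurable g ->
  bounded_measurable (fun s => f s + g s).
Proof.
move=> [mf [M fM]] [mg [N gN]]; split; first exact: measurable_funD.
by exists (M + N) => s; rewrite (le_trans (ler_normD _ _))// lerD.
Qed.

Lemma bounded_measurableM f g : bounded_measurable f -> bounded_measurable g ->
  bounded_measurable (fun s => f s * g s).
Proof.
move=> [mf [M fM]] [mg [N gN]]; split; first exact: measurable_funM.
by exists (M * N) => s; rewrite normrM ler_pM.
Qed.

Lemma bounded_measurableZ c f : bounded_measurable f ->
  bounded_measurable (fun s => c * f s).
Proof. exact/bounded_measurableM/bounded_measurable_cst. Qed.

Lemma bounded_measurableB f g : bounded_measurable f -> bounded_measurable g ->
  bounded_measurable (fun s => f s - g s).
Proof.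
move=> bf bg; rewrite (_ : (fun _ => _) = (fun s => f s + -1 * g s)).
  exact/bounded_measurableD/bounded_measurableZ.
by apply/funext => s; rewrite mulN1r.
Qed.

Lemma bounded_measurable_sqr f : bounded_measurable f ->
  bounded_measurable (fun s => f s ^+ 2).
Proof. by move=> bf; exact: bounded_measurableM. Qed.

Lemma bounded_measurable_sum (I : Type) (r : seq I) (f : I -> X -> R) :
  (forall i, bounded_measurable (f i)) ->
  bounded_measurable (fun s => \sum_(i <- r) f i s).
Proof.
move=> bf; elim: r => [|i r IHr].
  under eq_fun do rewrite big_nil.
  exact: bounded_measurable_cst.
under eq_fun do rewrite big_cons.
exact: bounded_measurableD.
Qed.

Context (m : {measure set X -> \bar R}) (m1 : m setT = 1%E).

Lemma bounded_measurable_integrable f : bounded_measurable f ->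
  m.-integrable setT (EFin \o f).
Proof.
move=> [mf [M fM]]; apply: measurable_bounded_integrable => //.
  by rewrite m1 ltry.
by exists M; split => [|y My]; rewrite ?num_real// => s _ /=; rewrite (le_trans (fM s))// ltW.
Qed.

Local Notation intble := bounded_measurable_integrable.

Lemma Rintegral_sum (I : Type) (r : seq I) (f : I -> X -> R) :
  (forall i, bounded_measurable (f i)) ->
  \int[m]_s (\sum_(i <- r) f i s) = \sum_(i <- r) \int[m]_s f i s.
Proof.
move=> bf; elim: r => [|i r IHr].
  under eq_Rintegral do rewrite big_nil.
  by rewrite big_nil Rintegral_cst// mul0r.
under eq_Rintegral do rewrite big_cons.
rewrite big_cons RintegralD ?IHr//; apply: intble => //.
exact: bounded_measurable_sum.
Qed.

Lemma le_Rintegral_bounded f g : bounded_measurable f -> bounded_measurable g ->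
  (forall s, f s <= g s) -> \int[m]_s f s <= \int[m]_s g s.
Proof. by move=> bf bg fg; apply: le_Rintegral => //; exact: intble. Qed.

(** Jensen's inequality for the square: the variance, the integral of [(f - e)^2] with [e] the mean,
    is nonnegative. *)
Lemma sqr_Rintegral_le f : bounded_measurable f ->
  (\int[m]_s f s) ^+ 2 <= \int[m]_s (f s ^+ 2).
Proof.
move=> bf; set e := \int[m]_s f s.
have be : bounded_measurable (fun s => (- (2 * e)) * f s + e ^+ 2).
  exact/bounded_measurableD/bounded_measurable_cst/bounded_measurableZ.
have : 0 <= \int[m]_s (f s ^+ 2 + ((- (2 * e)) * f s + e ^+ 2)).
  apply: Rintegral_ge0 => s _.
  by rewrite (_ : _ + _ = (f s - e) ^+ 2) ?sqr_ge0//; ring.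
rewrite RintegralD//; [|exact/intble/bounded_measurable_sqr|exact: intble].
rewrite RintegralD//; last 2 first.
- exact/intble/bounded_measurableZ.
- exact/intble/bounded_measurable_cst.
rewrite RintegralZl//; last exact: intble.
by rewrite Rintegral_cst//= m1/= mulr1 -/e; lra.
Qed.

(** Jensen's inequality for [g * f], followed by [g ^+ 2 <= M ^+ 2]; it acts as Cauchy-Schwarz with
    one bounded factor. *)
Lemma sqr_Rintegral_mul_le f g M :
  bounded_measurable f -> bounded_measurable g -> (forall s, `|g s| <= M) ->
  (\int[m]_s (g s * f s)) ^+ 2 <= M ^+ 2 * \int[m]_s (f s ^+ 2).
Proof.
move=> bf bg gM; have bf2 := bounded_measurable_sqr bf.
rewrite (le_trans (sqr_Rintegral_le (bounded_measurableM bg bf)))//.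
rewrite -RintegralZl//; last exact: intble.
apply: le_Rintegral_bounded => [||s].
- exact/bounded_measurable_sqr/bounded_measurableM.
- exact: bounded_measurableZ.
rewrite exprMn ler_wpM2r ?sqr_ge0// -real_normK ?num_real//.
by rewrite ler_sqr ?nnegrE ?(le_trans _ (gM s)).
Qed.

End bounded_measurable.

(** * The transition operator in the L2 space of the stationary distribution *)

Section kernel_operator.
Context d (X : measurableType d) (R : realType) (p : R.-pker X ~> X).
Implicit Types f g : X -> R.

Let p1 s : p s setT = 1%E := prob_kernel s.
Local Notation P f := (fun s => \int[p s]_t f t).

Lemma bounded_measurable_kernel f : bounded_measurable f ->
  bounded_measurable (P f).
Proof.
move=> bf; have [mf [M fM]] := bf; split; last first.
  exists M => s; have M0 := le_trans (normr_ge0 _) (fM s).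
  have pf : (p s).-integrable setT (EFin \o f).
    exact/(bounded_measurable_integrable (p1 s)).
  rewrite (le_trans (le_normr_Rintegral _ pf))//.
  rewrite (@le_trans _ _ (\int[p s]_t M))//; last first.
    by rewrite Rintegral_cst// prob_kernel mulr1.
  apply: (le_Rintegral_bounded (p1 s)) => //.
    by split; [exact: measurableT_comp|exists M => t; rewrite normr_id].
  exact: bounded_measurable_cst.
(* Measurability of the kernel integral is obtained for nonnegative functions, so [f] is raised by
   its bound; as [p s] has mass 1, subtracting [M] undoes this. *)
pose g s := f s + M.
have bg : bounded_measurable g.
  exact/bounded_measurableD/bounded_measurable_cst.
have g0 s : 0 <= g s by have := fM s; rewrite ler_norml /g => /andP[+ _]; lra.
rewrite (_ : P f = (fun s => fine (\int[p s]_t (g t)%:E) - M)); last first.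
  apply/funext => s; rewrite -[fine _]/(\int[p s]_t g t) RintegralD//; last 2 first.
  - exact: (bounded_measurable_integrable (p1 s)).
  - exact/(bounded_measurable_integrable (p1 s))/bounded_measurable_cst.
  by rewrite Rintegral_cst// prob_kernel/= mulr1 addrK.
apply: measurable_funB => //; apply: measurableT_comp => //.
apply: measurable_fun_integral_kernel => //.
- exact: measurable_kernel.
- exact/measurable_EFinP/bg.1.
Qed.

Context (mu : probability X R) (pmu : stationary p mu).

(** The iterated integral is an integral against [Z |-> \int[mu]_s p s Z], which stationarity
    identifies with [mu]. *)
Lemma stationary_Rintegral g : bounded_measurable g -> (forall s, 0 <= g s) ->
  \int[mu]_s P g s = \int[mu]_s g s.
Proof.
move=> bg g0; have mg : measurable_fun setT (EFin \o g).
  exact/measurable_EFinP/bg.1.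
congr fine.
under eq_integral => s _.
  rewrite fineK; last first.
    exact/integrable_fin_num/(bounded_measurable_integrable (p1 s)).
  over.
(* [mu] as a constant kernel: the composed measure [mu p] is then a [kcomp]. *)
pose mu' : pprobability X R := mu.
have mmu : measurable_fun [set: X] (cst mu') by exact: measurable_cst.
rewrite -(@integral_kcomp _ _ _ _ _ _ _ (kprobability mmu) (kernel.kernel_snd p) point)//=.
by apply: eq_measure_integral => Z mZ _; rewrite [RHS]pmu.
Qed.

Context (gamma : R) (gamma01 : 0 <= gamma < 1).

Local Notation T f := (fun s => gamma * (P f) s - f s).

Lemma bounded_measurable_td f : bounded_measurable f ->
  bounded_measurable (T f).
Proof.
move=> bf; apply: bounded_measurableB => //.
exact/bounded_measurableZ/bounded_measurable_kernel.
Qed.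

Let mu1 : mu setT = 1%E := probability_setT mu.
Local Notation intble := (bounded_measurable_integrable mu1).

Lemma Rintegral_sqr_kernel_le f : bounded_measurable f ->
  \int[mu]_s (P f s ^+ 2) <= \int[mu]_s (f s ^+ 2).
Proof.
move=> bf; have bf2 := bounded_measurable_sqr bf.
rewrite -(stationary_Rintegral bf2) => [|s]; last exact: sqr_ge0.
apply: (le_Rintegral_bounded mu1) => [||s].
- exact/bounded_measurable_sqr/bounded_measurable_kernel.
- exact: bounded_measurable_kernel.
- exact: (sqr_Rintegral_le (p1 s)).
Qed.

(** Young's inequality [2 f P f <= (P f)^2 + f^2] with weight [gamma / 2], then the contraction
    property of [P]; the coefficients add up to [gamma / 2 + gamma / 2 - 1]. *)
Lemma td_dissipative f : bounded_measurable f ->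
  \int[mu]_s (f s * T f s) <= - (1 - gamma) * \int[mu]_s (f s ^+ 2).
Proof.
move=> bf; have bf2 := bounded_measurable_sqr bf.
have bP := bounded_measurable_kernel bf; have bP2 := bounded_measurable_sqr bP.
have /andP[g0 g1] := gamma01.
have : \int[mu]_s (f s * T f s) <=
    \int[mu]_s ((gamma / 2) * P f s ^+ 2 + (gamma / 2 - 1) * f s ^+ 2).
  apply: (le_Rintegral_bounded mu1) => [||s].
  - exact/bounded_measurableM/bounded_measurable_td.
  - by apply: bounded_measurableD; exact: bounded_measurableZ.
  - have := mulr_ge0 g0 (sqr_ge0 (P f s - f s)).
    by set u := Rintegral _ _ _; set v := f s; lra.
rewrite RintegralD//; try exact/intble/bounded_measurableZ.
rewrite !RintegralZl//; try exact: intble.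
have := ler_wpM2l g0 (Rintegral_sqr_kernel_le bf).
by lra.
Qed.

(** The constant is [2 + 2], from [(a - b)^2 <= 2 a^2 + 2 b^2], [gamma < 1] and the contraction
    property. *)
Lemma Rintegral_sqr_td_le f : bounded_measurable f ->
  \int[mu]_s (T f s ^+ 2) <= 4 * \int[mu]_s (f s ^+ 2).
Proof.
move=> bf; have bf2 := bounded_measurable_sqr bf.
have bP := bounded_measurable_kernel bf; have bP2 := bounded_measurable_sqr bP.
have /andP[g0 g1] := gamma01.
have : \int[mu]_s (T f s ^+ 2) <= \int[mu]_s (2 * P f s ^+ 2 + 2 * f s ^+ 2).
  apply: (le_Rintegral_bounded mu1) => [||s].
  - exact/bounded_measurable_sqr/bounded_measurable_td.
  - by apply: bounded_measurableD; exact: bounded_measurableZ.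
  - have := sqr_ge0 (gamma * P f s + f s).
    have : (gamma * P f s) ^+ 2 <= P f s ^+ 2.
      by rewrite exprMn ler_piMl ?sqr_ge0// exprn_ile1// ltW.
    by set u := Rintegral _ _ _; set v := f s; lra.
rewrite RintegralD//; try exact/intble/bounded_measurableZ.
rewrite !RintegralZl//; try exact: intble.
by have := Rintegral_sqr_kernel_le bf; lra.
Qed.

End kernel_operator.

(** * Quadratic form and kernel of the matrix *)

Section td_matrix.
Context d (X : measurableType d) (R : realType) (p : R.-pker X ~> X).
Context (mu : probability X R) (pmu : stationary p mu).
Context (gamma : R) (gamma01 : 0 <= gamma < 1).
Context (k : nat) (x : X -> 'cV[R]_k).
Hypothesis bx : forall i, bounded_measurable (fun s => x s i 0).

Local Notation T f := (fun s => gamma * (\int[p s]_t f t) - f s).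
Local Notation A := (td_matrix p mu gamma x).
Local Notation f z := (fun s => dotv z (x s)).
Local Notation q z := (\int[mu]_s (dotv z (x s) ^+ 2)).

Let mu1 : mu setT = 1%E := probability_setT mu.

Lemma bounded_measurable_dotv z : bounded_measurable (f z).
Proof.
under eq_fun do rewrite dotvE.
by apply: bounded_measurable_sum => i; exact: bounded_measurableZ.
Qed.

Let bf := bounded_measurable_dotv.

Let bT i : bounded_measurable (T (fun s => x s i 0)).
Proof. exact: bounded_measurable_td. Qed.

Lemma Rintegral_dotv (m : {measure set X -> \bar R}) z g :
  m setT = 1%E -> bounded_measurable g ->
  \int[m]_s (dotv z (x s) * g s) = \sum_i z i 0 * \int[m]_s (x s i 0 * g s).
Proof.
move=> m1 bg.
under eq_Rintegral => s _.
  rewrite dotvE mulr_suml; under eq_bigr do rewrite -mulrA; over.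
have bxg i : bounded_measurable (fun s => x s i 0 * g s).
  exact: bounded_measurableM.
rewrite Rintegral_sum// => [|i]; last exact: bounded_measurableZ.
apply: eq_bigr => i _; rewrite RintegralZl//.
exact: (bounded_measurable_integrable m1).
Qed.

Lemma td_dotv z s : T (f z) s = \sum_j z j 0 * T (fun s => x s j 0) s.
Proof.
(* Linearity of the integral under [p s], as the case of weight 1. *)
have := @Rintegral_dotv (p s) z (fun=> 1) (prob_kernel s)
  (bounded_measurable_cst _ _).
under eq_Rintegral do rewrite mulr1.
move=> ->; rewrite dotvE mulr_sumr -sumrB; apply: eq_bigr => j _.
by under eq_Rintegral do rewrite mulr1; ring.
Qed.

(** [A] represents the bilinear form [(f, g) |-> \int f T g] on the features; contracting it with
    [z] on either side yields the formulas that follow. *)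
Lemma td_matrixE i j :
  A i j = \int[mu]_s (x s i 0 * T (fun s => x s j 0) s).
Proof.
by rewrite mxE; apply: eq_Rintegral => s _; rewrite !mxE big_ord1 !mxE.
Qed.

Lemma mulmx_td z i : (A *m z) i 0 = \int[mu]_s (x s i 0 * T (f z) s).
Proof.
under eq_Rintegral do rewrite td_dotv mulr_sumr.
have bxT j : bounded_measurable (fun s => x s i 0 * T (fun s => x s j 0) s).
  exact: bounded_measurableM.
under eq_Rintegral => s _ do under eq_bigr do rewrite mulrCA.
rewrite mxE Rintegral_sum// => [|j]; last exact: bounded_measurableZ.
apply: eq_bigr => j _; rewrite RintegralZl//.
  by rewrite mulrC td_matrixE.
exact: (bounded_measurable_integrable mu1).
Qed.

Lemma trmx_td_mulmx z j :
  (A^T *m z) j 0 = \int[mu]_s (dotv z (x s) * T (fun s => x s j 0) s).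
Proof.
rewrite Rintegral_dotv// mxE; apply: eq_bigr => i _.
by rewrite mxE td_matrixE mulrC.
Qed.

Lemma dotv_td z : dotv z (A *m z) = \int[mu]_s (dotv z (x s) * T (f z) s).
Proof.
rewrite Rintegral_dotv//; last exact: bounded_measurable_td.
by rewrite dotvE; apply: eq_bigr => i _; rewrite mulmx_td.
Qed.

Lemma td_vector_mulmx (r : X -> R) (z : 'cV[R]_k) : bounded_measurable r ->
  (td_vector mu r x)^T *m z = (\int[mu]_s (r s * dotv z (x s)))%:M.
Proof.
move=> br; under eq_Rintegral do rewrite mulrC.
rewrite Rintegral_dotv//; apply/matrixP => a b; rewrite !ord1 !mxE/= mulr1n.
apply: eq_bigr => i _; rewrite !mxE mulrC; congr (_ * _).
by apply: eq_Rintegral => s _; rewrite mxE mulrC.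
Qed.

Let q0 z : 0 <= q z.
Proof. by apply: Rintegral_ge0 => s _; exact: sqr_ge0. Qed.

Let gamma1 : 0 < 1 - gamma.
Proof. by rewrite subr_gt0; case/andP: gamma01. Qed.

Lemma td_dotv_le z : dotv z (A *m z) <= - (1 - gamma) * q z.
Proof. by rewrite dotv_td; exact: td_dissipative. Qed.

Lemma td_dotv_eq0 z : dotv z (A *m z) = 0 -> q z = 0.
Proof.
move=> zAz; apply/eqP; rewrite eq_le q0 andbT -(pmulr_rle0 _ gamma1).
by have := td_dotv_le z; rewrite zAz; lra.
Qed.

(** The square of the integral is at most [M ^+ 2 * q z]: a function null in L2 is orthogonal to
    every bounded one. *)
Lemma Rintegral_mul_dotv_eq0 z h : bounded_measurable h -> q z = 0 ->
  \int[mu]_s (h s * dotv z (x s)) = 0.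
Proof.
move=> bh qz; have [_ [M hM]] := bh.
have := sqr_Rintegral_mul_le mu1 (bf z) bh hM.
by rewrite qz mulr0 => h0; apply/eqP; rewrite -sqrf_eq0 eq_le h0 sqr_ge0.
Qed.

(** [A z = 0] annihilates the quadratic form, hence [q z], and the coordinates of [A^T z] are
    integrals with factor [f z]. *)
Lemma td_ker_trmx (z : 'cV[R]_k) : A *m z = 0 -> A^T *m z = 0.
Proof.
move=> Az; apply/colP => j; rewrite trmx_td_mulmx mxE.
under eq_Rintegral do rewrite mulrC.
apply: Rintegral_mul_dotv_eq0 => //; apply: td_dotv_eq0.
by rewrite Az /dotv mulmx0 mxE.
Qed.

(** [z^T A z] vanishes when [A^T z] does, so again [q z = 0]; the product is the integral of
    [r * f z]. *)
Lemma td_vector_ker r (z : 'cV[R]_k) : bounded_measurable r ->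
  A^T *m z = 0 -> (td_vector mu r x)^T *m z = 0.
Proof.
move=> br Az; rewrite td_vector_mulmx// Rintegral_mul_dotv_eq0 ?raddf0//.
apply: td_dotv_eq0.
by rewrite /dotv mulmxA -[z^T *m A]trmxK trmx_mul trmxK Az trmx0 mul0mx mxE.
Qed.

Lemma td_coercive : exists2 c, 0 < c &
  forall z, dotv z (A *m z) <= - c * dotv (A *m z) (A *m z).
Proof.
pose M i := sval (cid (bx i).2).
have xM i s : `|x s i 0| <= M i by exact: (svalP (cid (bx i).2)).
(* The [i]-th coordinate of [A z] has square at most [4 * M i ^+ 2 * q z]; the added 1 makes [D] a
   legitimate divisor. *)
pose D := 1 + \sum_i 4 * M i ^+ 2.
have D0 : 0 < D by rewrite ltr_pwDl// sumr_ge0// => i _; rewrite mulr_ge0 ?sqr_ge0.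
have AzD z : dotv (A *m z) (A *m z) <= D * q z.
  apply: (@le_trans _ _ ((\sum_i 4 * M i ^+ 2) * q z)); last first.
    by rewrite ler_wpM2r// lerDr.
  rewrite dotvE mulr_suml; apply: ler_sum => i _.
  have bTz : bounded_measurable (T (f z)) by exact: bounded_measurable_td.
  rewrite -expr2 mulmx_td (le_trans (sqr_Rintegral_mul_le mu1 bTz (bx i) (xM i)))//.
  have := Rintegral_sqr_td_le pmu gamma01 (bf z).
  by move/(ler_wpM2l (sqr_ge0 (M i))); rewrite mulrCA mulrA.
(* This constant eliminates [q z] between [td_dotv_le] and [AzD]. *)
exists ((1 - gamma) / D); first by rewrite divr_gt0.
move=> z; rewrite (le_trans (td_dotv_le z))// !mulNr lerN2 -mulrA.
by rewrite ler_wpM2l ?(ltW gamma1)// mulrC ler_pdivrMr// mulrC.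
Qed.

End td_matrix.

(** * Passage to coordinates and conclusion *)

Lemma norm_coord_le (R : realType) m n (M : 'M[R]_(m, n)) i j : `|M i j| <= `|M|.
Proof. by rewrite [leRHS]/Num.Def.normr/= mx_normrE (le_bigmax _ _ (i, j)). Qed.

(** Open intervals generate the Borel sets of the line, and their preimages under the continuous
    coordinate map are open. *)
Lemma borel_fun_coord d (X : measurableType d) (R : realType) m n
    (x : X -> 'M[R]_(m, n)) i j :
  borel_fun x -> measurable_fun setT (fun s => x s i j).
Proof.
move=> mx; apply: (measurability _ (RGenOpens.measurableE R)).
move=> _ [_ [a [b ->]] <-].
apply: (mx measurableT ((fun M : 'M[R]_(m, n) => M i j) @^-1` `]a, b[%classic)).
apply: sub_sigma_algebra.
by apply: open_comp => [M _|]; [exact: coord_continuous|exact: interval_open].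
Qed.

Theorem corollary14 (R : realType) (K d : nat)
  (S : set 'cV[R]_K) (S0 : S !=set0)
  (p : R.-pker borelType (subspace_type S0) ~> borelType (subspace_type S0))
  (r : borelType (subspace_type S0) -> R)
  (gamma : R)
  (x : borelType (subspace_type S0) -> 'cV[R]_d)
  (mu : probability (borelType (subspace_type S0)) R)
  (W : set 'cV[R]_d) :
  measurable_fun setT r ->
  0 <= gamma < 1 ->
  borel_fun x ->
  unique_stationary p mu ->
  (forall U : set (subspace_type S0), open U -> U !=set0 -> (0 < mu U)%E) ->
  bounded_fun x ->
  bounded_fun r ->
  (forall (n : nat) (f : borelType (subspace_type S0) -> 'cV[R]_n),
    borel_fun f ->
    {ae mu, forall s, f s = 0} ->
    {ae mu, forall s, transition_op p f s = 0}) ->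
  bounded_set W ->
  affine_ode_invariant (td_matrix p mu gamma x) (td_vector mu r x) W ->
  W `<=` affine_zeros (td_matrix p mu gamma x) (td_vector mu r x).
Proof.
move=> mr gamma01 mx [pmu _] _ [M [_ xM]] [N [_ rN]] _ [B [_ WB]] invW w0 Ww0.
have br : bounded_measurable r.
  (* Boundedness is given as: every real above the threshold [N] is a bound; hence [N + 1]. *)
  by split => //; exists (N + 1) => s; apply: rN => //; rewrite ltrDl.
have bx i : bounded_measurable (fun s => x s i 0).
  split; first exact: borel_fun_coord.
  exists (M + 1) => s; rewrite (le_trans (norm_coord_le _ _ _))//.
  by apply: xM => //; rewrite ltrDl.
(* By invariance this solution through [w0] stays in [W], hence is bounded also backwards in
   time. *)
have [w wsol ww0] := affine_ode_solution_exists
  (td_matrix p mu gamma x) (td_vector mu r x) w0.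
have [c c0 Ac] := td_coercive pmu gamma01 bx.
rewrite /affine_zeros/= -ww0.
apply: (bounded_affine_ode_solution (M := B + 1) c0 Ac _ _ wsol) => [z|z|t i].
- exact: td_ker_trmx.
- exact: td_vector_ker.
- rewrite (le_trans (norm_coord_le _ _ _))//; apply: WB; first by rewrite ltrDl.
  by apply: invW wsol _ t; rewrite ww0.
Qed.
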